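(* Let $G$ be a cluster graph and $k,\eta$ non-negative integers, and suppose $F\subseteq\binom{V(G)}{2}\setminus E(G)$ satisfies $|F|\le k$ and $G+F$ is an $\eta$-balanced cluster graph. Let $\mathcal{H}$ be the set of connected components of $G$ that $F$ modifies. Then (1) $|V(H)|\le k$ for every $H\in\mathcal{H}$, and (2) $\sum_{H\in\mathcal{H}}|V(H)|\le 2k$.
   Context: A cluster graph is a graph in which every connected component is a clique; a graph is $\eta$-balanced if any two of its connected components differ in number of vertices by at most $\eta$. $G+F=(V(G),E(G)\cup F)$. $F$ modifies a vertex $v$ if $v$ is an endpoint of some pair in $F$, and $F$ modifies a connected component $H$ of $G$ if it modifies at least one vertex of $H$. *)

(* Defs.v *)
From mathcomp Require Export all_boot.

Set Implicit Arguments.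
Unset Strict Implicit.
Unset Printing Implicit Defensive.

(* A finite simple graph is given by its vertex type V and its edge set
   E : {set {set V}}, subject to [simple_graph E]; thus V(G) = V, E(G) = E,
   and G + F is the edge set E :|: F on the same vertex type. *)
Section Graphs.

Variable V : finType.
Implicit Types (E F : {set {set V}}) (C : {set V}).

Definition vpairs : {set {set V}} := [set e : {set V} | #|e| == 2].

Definition simple_graph E : bool := E \subset vpairs.

(* For a simple graph this is irreflexive, since [set x; x] has cardinal 1. *)
Definition adj E : rel V := fun x y => [set x; y] \in E.

Definition components E : {set {set V}} :=
  equivalence_partition (connect (adj E)) [set: V].

Definition clique E C : bool :=
  [forall x in C, forall y in C, (x != y) ==> adj E x y].

Definition cluster_graph E : bool := [forall C in components E, clique E C].

(* C and D range over ordered pairs, so this bounds the absolute difference. *)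
Definition balanced (eta : nat) E : bool :=
  [forall C in components E, forall D in components E, #|C| <= #|D| + eta].

Definition modifies_vertex F (v : V) : bool := [exists e in F, v \in e].

Definition modifies F C : bool := [exists v in C, modifies_vertex F v].

Definition modified_components E F : {set {set V}} :=
  [set C in components E | modifies F C].

End Graphs.

Arguments vpairs V : clear implicits.

(* Main.v *)
Require Import Defs.

(** If [F] joins a vertex of a component [H] of [G] to a vertex [u], then [u]
    lies outside [H] because [H] is a clique, while [u] and all of [H] lie in a
    single clique of [G + F]; hence [F] contains every pair [{x, u}] with [x] in
    [H].  These are [#|H|] distinct pairs, which gives (1), and every vertex of a
    modified component is covered by the pairs of [F], which gives (2). *)

Section ClusterGraphs.

Set Implicit Arguments.
Unset Strict Implicit.

Variable V : finType.
Implicit Types (E F : {set {set V}}) (C H : {set V}) (x y : V).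

Lemma adj_sym E : symmetric (adj E).
Proof. by move=> x y; rewrite /adj setUC. Qed.

Lemma connect_adj_equiv E : equivalence_rel (connect (adj E)).
Proof.
have csym : connect_sym (adj E) by apply: sym_connect_sym; exact: adj_sym.
move=> x y z; split; first exact: connect0.
by move=> xy; exact: same_connect.
Qed.

Lemma components_partition E : partition (components E) [set: V].
Proof.
by apply: equivalence_partitionP => x y z _ _ _; exact: connect_adj_equiv.
Qed.

Lemma mem_components E C x :
  C \in components E -> x \in C -> forall y, (y \in C) = connect (adj E) x y.
Proof.
case/imsetP => x0 _ ->; rewrite 2!inE /= => x0x y; rewrite 2!inE /=.
by have [_ /(_ x0x)] := connect_adj_equiv E x0 x y.
Qed.

(** The form in which the cluster property is used, once for [G] and once for [G + F]: it turns a
    path into an edge. *)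
Lemma cluster_adj E x y :
  cluster_graph E -> connect (adj E) x y -> x != y -> adj E x y.
Proof.
move=> /'forall_implyP clE xy; have /andP[/eqP covE _] := components_partition E.
have : x \in cover (components E) by rewrite covE inE.
case/bigcupP => C compC xC.
have yC : y \in C by rewrite (mem_components compC xC).
by have /'forall_implyP/(_ x xC)/'forall_implyP/(_ y yC)/implyP := clE C compC.
Qed.

Lemma modified_component_join E F H :
  cluster_graph E -> F \subset vpairs V :\: E -> cluster_graph (E :|: F) ->
  H \in modified_components E F ->
  exists2 u, u \notin H & {in H, forall x, [set x; u] \in F}.
Proof.
move=> clE sFE clEF; rewrite inE => /andP[compH].
case/'exists_andP => v [vH /'exists_andP[e [eF ve]]].
have /setDP[] := subsetP sFE e eF; rewrite inE => /cards2P[a [b [nab def_e]]] eE.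
have [u nvu {}def_e] : exists2 u, v != u & e = [set v; u].
  move: ve; rewrite def_e !inE => /orP[]/eqP->; first by exists b.
  by exists a; rewrite 1?eq_sym // setUC.
rewrite {}def_e in eF eE.
(* Otherwise [v] and [u] would already be adjacent in the clique [H], whereas [F] avoids [E]. *)
have uH : u \notin H.
  apply: contra eE; rewrite (mem_components compH vH) => vu.
  exact: cluster_adj.
exists u => // x xH; have nxu : x != u by apply: contraNneq uH => <-.
(* In [G + F], go from [x] to [v] along edges of [G], then to [u] by the pair from [F]; the cluster
   property shortcuts this path. *)
have : adj (E :|: F) x u.
  apply: cluster_adj => //; apply: (@connect_trans _ _ v).
    have := vH; rewrite (mem_components compH xH); apply: connect_sub => y z yz.
    by apply: connect1; rewrite /adj inE [_ \in E]yz.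
  by apply: connect1; rewrite /adj inE eF orbT.
(* The edge cannot come from [E], which would put [u] in [H]. *)
rewrite /adj inE => /orP[xuE|//]; case/negP: uH.
by rewrite (mem_components compH xH) connect1.
Qed.

Lemma card_cover_pairs F : F \subset vpairs V -> #|cover F| <= 2 * #|F|.
Proof.
move=> /subsetP sF; apply: leq_trans (leq_card_cover F) _.
rewrite mulnC -sum_nat_const leq_sum // => e /sF.
by rewrite inE => /eqP->.
Qed.

(** Components are disjoint, so (2) reduces to comparing two vertex sets: the union of the modified
    components and the vertices covered by [F]. *)
Lemma sum_card_modified E F :
  \sum_(H in modified_components E F) #|H| = #|cover (modified_components E F)|.
Proof.
apply/eqP; suff: trivIset (modified_components E F) by rewrite /trivIset.
have /and3P[_ tE _] := components_partition E.
by apply: trivIsetS tE; apply/subsetP => C; rewrite inE => /andP[].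
Qed.

End ClusterGraphs.

Theorem mainTheorem18 (V : finType) (E : {set {set V}}) (k eta : nat)
    (F : {set {set V}}) :
  simple_graph E -> cluster_graph E ->
  F \subset vpairs V :\: E ->
  #|F| <= k ->
  cluster_graph (E :|: F) -> balanced eta (E :|: F) ->
  (forall H : {set V}, H \in modified_components E F -> #|H| <= k) /\
  \sum_(H in modified_components E F) #|H| <= 2 * k.
Proof.
move=> _ clE sFE leFk clEF _; split=> [H modH|].
  have [u uH joinF] := modified_component_join clE sFE clEF modH.
  apply: leq_trans leFk; rewrite -(card_in_imset (f := fun x => [set x; u])).
    by apply/subset_leq_card/subsetP => _ /imsetP[x xH ->]; exact: joinF.
  (* Injectivity: [x] lies in [[set y; u]], and [x] differs from [u] because [u] is outside [H]. *)
  move=> x y xH _ /setP/(_ x); rewrite !inE eqxx /= => /esym/orP[/eqP//|/eqP xu].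
  by rewrite xu (negPf uH) in xH.
rewrite sum_card_modified; apply: leq_trans (_ : 2 * #|F| <= _); last first.
  by rewrite leq_mul2l.
apply: leq_trans (card_cover_pairs (subset_trans sFE (subsetDl _ _))).
apply/subset_leq_card/subsetP => x /bigcupP[H modH xH].
have [u _ joinF] := modified_component_join clE sFE clEF modH.
by apply/bigcupP; exists [set x; u]; [exact: joinF | rewrite set21].
Qed.
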